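(* Let $r\ge 0$ be a fixed integer and let $\alpha=(\alpha_0,\dots,\alpha_r)$ be fixed positive real numbers such that $\alpha_i\notin\mathbb Z$ for all $i$ and $\alpha_i-\alpha_j\notin\mathbb Z$ for all $i\neq j$. For each $n$, let $Y\subseteq\Delta_n$ be a random simplicial complex distributed according to the upper probability measure $\overline{\mathbb P}_n$ with probability parameters $p_\sigma=n^{-\alpha_i}$ if $\dim\sigma=i\le r$ and $p_\sigma=0$ if $\dim\sigma>r$. For $k\in\{0,1,\dots,r\}$ let $f_k=f_k(Y)$ be the number of $k$-dimensional simplexes of $Y$ and let $$\gamma_k:=\lim_{n\to\infty}\frac{\log\mathbb E(f_k)}{\log n}.$$ Then $$\gamma_k=\begin{cases}k+1,& k<k^\ast,\\ \beta^\ast,& k^\ast\le k\le i^\ast,\\ \beta_k^\ast,& k>i^\ast.\end{cases}$$ In particular, the value of $\gamma_k$ is constant, maximal and equal to $\beta^\ast$ for all $k$ satisfying $k^\ast\le k\le i^\ast$.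
   Context: $[n]=\{0,1,\dots,n\}$; $\Delta_n$ is the simplicial complex of all non-empty subsets (simplexes) of $[n]$, with $\dim\sigma=|\sigma|-1$. A hypergraph is any set $X$ of non-empty subsets of $[n]$; a simplicial complex is a hypergraph closed under taking non-empty subsets (the empty complex is allowed). Given $p_\sigma\in[0,1]$ for each $\sigma\in\Delta_n$, a random hypergraph $X$ includes each $\sigma$ independently with probability $p_\sigma$. Let $\overline X$ be the smallest simplicial complex containing $X$, i.e. all non-empty subsets of members of $X$. The upper measure $\overline{\mathbb P}_n$ on the set of simplicial complexes $Y\subseteq\Delta_n$ is the distribution of $\overline X$; $\mathbb E$ is expectation with respect to $\overline{\mathbb P}_n$. Given the exponents $\alpha_0,\dots,\alpha_r$, put $\beta_i=i+1-\alpha_i$, $\beta^\ast=\max\{\beta_0,\dots,\beta_r\}$ and $\beta_k^\ast=\max\{\beta_k,\beta_{k+1},\dots,\beta_r\}$. The critical dimension is $k^\ast=\lfloor\beta^\ast\rfloor$, and $i^\ast$ is the unique index in $\{0,\dots,r\}$ with $\beta_{i^\ast}=\beta^\ast$ (one has $k^\ast\le i^\ast$). *)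

(* Defs.v *)
From HB Require Import structures.
From mathcomp Require Export all_boot all_order all_algebra.
From mathcomp Require Export all_classical all_reals all_analysis.
(* Restores set0 and the other finite-set names shadowed by classical_sets. *)
From mathcomp Require Export fintype finset.
Export Order.TTheory GRing.Theory Num.Theory.
Export numFieldNormedType.Exports.

Set Implicit Arguments.
Unset Strict Implicit.
Unset Printing Implicit Defensive.

Local Open Scope ring_scope.

Section Hypergraphs.
Variable V : finType.
Implicit Types (X Y : {set {set V}}) (s t : {set V}).

Definition simplexes : {set {set V}} := [set s | s != set0].

Definition is_hypergraph X : bool := X \subset simplexes.

Definition is_complex Y : bool :=
  is_hypergraph Y &&
  [forall s in Y, forall t in simplexes, (t \subset s) ==> (t \in Y)].

Definition complex_closure X : {set {set V}} :=
  [set s in simplexes | [exists t in X, s \subset t]].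

(* Only meaningful for s nonempty; #|set0|.-1 = 0. *)
Definition dim s : nat := #|s|.-1.

Definition face_count (k : nat) Y : nat :=
  #|[set s in Y | (s != set0) && (dim s == k)]|.

Lemma complex_closure_complex X : is_complex (complex_closure X).
Proof.
apply/andP; split.
  by apply/subsetP => s; rewrite inE => /andP[].
apply/'forall_implyP => s; rewrite inE => /andP[_ /'exists_andP[u [uX su]]].
apply/'forall_implyP => t t0; apply/implyP => ts.
rewrite inE t0; apply/'exists_andP; exists u; split => //.
exact: fintype.subset_trans ts su.
Qed.

Lemma sub_complex_closure X : is_hypergraph X -> X \subset complex_closure X.
Proof.
move=> /subsetP hX; apply/subsetP => s sX.
by rewrite inE hX //=; apply/'exists_andP; exists s.
Qed.

Lemma complex_closure_min X Y :
  is_complex Y -> X \subset Y -> complex_closure X \subset Y.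
Proof.
move=> /andP[_ /'forall_implyP cY] /subsetP XY; apply/subsetP => s.
rewrite inE => /andP[s0 /'exists_andP[t [/XY tY st]]].
by have /'forall_implyP/(_ s s0)/implyP := cY t tY; exact.
Qed.

Variable R : realType.
Implicit Types p : {set V} -> R.

Definition hypergraph_prob p X : R :=
  \prod_(s in simplexes) (if s \in X then p s else 1 - p s).

Definition upper_measure p Y : R :=
  \sum_(X | is_hypergraph X && (complex_closure X == Y)) hypergraph_prob p X.

Definition upper_expectation p (f : {set {set V}} -> R) : R :=
  \sum_(Y | is_complex Y) upper_measure p Y * f Y.

Lemma hypergraph_prob_total p :
  \sum_(X | is_hypergraph X) hypergraph_prob p X = 1.
Proof.
pose F s := if s \in simplexes then p s else 0.
pose G s := if s \in simplexes then 1 - p s else 1.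
have <- : \prod_s (F s + G s) = 1.
  by rewrite big1// => s _; rewrite /F /G; case: ifP; rewrite ?add0r// addrC subrK.
rewrite bigA_distr big_mkcond; apply: eq_bigr => X _.
case: ifPn => [/fintype.subsetP XS | /subsetPn[s sX sS]]; last first.
  by rewrite (bigD1 s)//= sX /F (negPf sS) mul0r.
rewrite /hypergraph_prob big_mkcond; apply: eq_bigr => s _.
by rewrite /F /G; case: ifP => // sS; case: ifP => // /XS; rewrite sS.
Qed.

Lemma upper_measure_total p : \sum_(Y | is_complex Y) upper_measure p Y = 1.
Proof.
rewrite -(hypergraph_prob_total p); apply/esym.
rewrite (partition_big (fun X => complex_closure X) (fun Y => is_complex Y))// => X _.
exact: complex_closure_complex.
Qed.

End Hypergraphs.

Section Exponents.
Variables (R : realType) (r : nat) (alpha : 'I_r.+1 -> R).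

(* The i-dimensional simplexes of [n] = {0, ..., n}, encoded as 'I_n.+1, get
   n ^ (- alpha i); [insub] returns [None] exactly when the dimension
   exceeds r. *)
Definition face_prob (n : nat) (s : {set 'I_n.+1}) : R :=
  if insub (dim s) is Some i then n%:R `^ (- alpha i) else 0.

Definition expected_faces (k n : nat) : R :=
  upper_expectation (@face_prob n) (fun Y => (face_count k Y)%:R).

Definition growth_seq (k n : nat) : R := ln (expected_faces k n) / ln n%:R.

(* [limn] is only meaningful together with [cvgn (growth_seq k)]. *)
Definition gamma (k : nat) : R := limn (growth_seq k).

Definition beta (i : 'I_r.+1) : R := i%:R + 1 - alpha i.

Definition beta_star : R := \big[Num.max/beta ord0]_(i < r.+1) beta i.

Definition beta_star_from (k : 'I_r.+1) : R :=
  \big[Num.max/beta k]_(i < r.+1 | (k <= i)%N) beta i.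

Definition critical_dim : int := Num.floor beta_star.

End Exponents.

(* Main.v *)
Require Import Defs.
From mathcomp Require Import ring lra zify.

Set Implicit Arguments.
Unset Strict Implicit.
Unset Printing Implicit Defensive.

Local Open Scope classical_set_scope.
Local Open Scope ring_scope.

(** Write [b_k] for [beta_star_from alpha k].  All three cases of the formula
    come from the single identity
      [gamma alpha k = min (k + 1) b_k]   ([gammaE]).

    By linearity the expected number of [k]-faces is the number
    ['C(n + 1, k + 1)] of candidates [s], of order [n ^ (k + 1)], times the
    probability that [s] lies under some member of the random hypergraph.  The
    sets [t] above [s] are present independently of each other, so this
    probability is [1 - \prod_(t >= s) (1 - p t)]
    ([upper_expectation_face_count]).  If [S] is the expected number of members
    of the hypergraph above [s], such a quantity lies between [S / (1 + S)] and
    [min 1 S] ([onem_prod_bounds]): it behaves like [S] when [S] is small and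
    saturates at a positive constant when [S] is large.

    There are ['C(n - k, i - k)] cofaces of [s] of dimension [i], each present
    with probability [n ^ (- alpha i)], so they contribute to [S] a term of order
    [n ^ (i - k - alpha i) = n ^ (beta i - (k + 1))], and [S] has order
    [n ^ (b_k - (k + 1))].  Hence the coverage probability has order
    [n ^ (min 0 (b_k - (k + 1)))] and the expectation has order
    [n ^ (min (k + 1) b_k)] ([has_growth_expected_faces]).  Orders of growth are
    handled by the predicate [has_growth], which is stable under products,
    finite sums and saturation, and which determines the limit of the ratio of
    logarithms.

    The cases then come from arithmetic.  As [alpha i > 0], one has
    [beta i < i + 1], so [beta_star < istar + 1].  If [k < floor beta_star] then
    [k < istar], so [b_k = beta_star >= k + 1]; if
    [floor beta_star <= k <= istar] then [b_k = beta_star < k + 1]; and if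
    [k > istar] then [b_k <= beta_star < istar + 1 <= k + 1].  Uniqueness of
    [istar] is the injectivity of [beta], because [beta i = beta j] makes
    [alpha i - alpha j] the integer [i - j]. *)

(** * Expected face numbers of the closure of a random hypergraph *)

Section Closure.
Variables (V : finType) (R : realType).
Implicit Types (p : {set V} -> R) (s t : {set V}) (X Y : {set {set V}}).

Lemma upper_expectationE p (f : {set {set V}} -> R) :
  upper_expectation p f =
  \sum_(X | is_hypergraph X) hypergraph_prob p X * f (complex_closure X).
Proof.
rewrite [RHS](partition_big (@complex_closure V) (@is_complex V)); last first.
  by move=> X _; exact: complex_closure_complex.
apply: eq_bigr => Y _; rewrite /upper_measure mulr_suml.
by apply: eq_bigr => X /andP[_ /eqP ->].
Qed.

Definition avoid_prob p s : R :=
  \prod_(t in simplexes V | s \subset t) (1 - p t).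

Lemma mem_complex_closure X s :
  s != set0 -> (s \in complex_closure X) = [exists t in X, s \subset t].
Proof. by move=> s0; rewrite !inE s0. Qed.

(** Let [p'] be [p] with the parameters of all sets containing [s] replaced by
    [0].  A hypergraph avoiding these sets has [p]-weight equal to [avoid_prob p s]
    times its [p']-weight, and any other hypergraph has [p']-weight zero, so the
    identity is the total mass of the [p']-measure. *)
Lemma avoid_probE p s : s != set0 ->
  \sum_(X | is_hypergraph X) hypergraph_prob p X * (s \notin complex_closure X)%:R
  = avoid_prob p s.
Proof.
move=> s0; pose p' t := if s \subset t then 0 else p t.
rewrite -[RHS]mulr1 -[in RHS](hypergraph_prob_total p') mulr_sumr.
apply: eq_bigr => X /fintype.subsetP hX; rewrite mem_complex_closure//.
have [/'exists_andP[t [tX st]]|] := boolP [exists t in X, s \subset t].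
  rewrite /= mulr0 /hypergraph_prob (bigD1 t) ?hX//=.
  by rewrite tX /p' st mul0r mulr0.
rewrite negb_exists => /forallP nst; rewrite /= mulr1.
have avoids t : s \subset t -> (t \in X) = false.
  by move=> st; have := nst t; rewrite st andbT => /negPf.
rewrite /hypergraph_prob (bigID (fun t => s \subset t))/=.
rewrite [in RHS](bigID (fun t => s \subset t))/=.
rewrite [X in _ * (X * _)]big1 ?mul1r; last first.
  by move=> t /andP[_ st]; rewrite /p' st subr0 avoids.
congr (_ * _); apply: eq_bigr => t /andP[_ st]; first by rewrite avoids.
by rewrite /p' (negPf st).
Qed.

Lemma upper_expectation_face_count p k :
  upper_expectation p (fun Y => (face_count k Y)%:R) =
  \sum_(s : {set V} | #|s| == k.+1) (1 - avoid_prob p s).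
Proof.
rewrite upper_expectationE.
transitivity (\sum_(X | is_hypergraph X) \sum_(s : {set V} | #|s| == k.+1)
   hypergraph_prob p X * (s \in complex_closure X)%:R).
  apply: eq_bigr => X _; rewrite -mulr_sumr -natr_sum; congr (_ * _%:R).
  rewrite /face_count cardsE -sum1_card big_mkcond [RHS]big_mkcond.
  apply: eq_bigr => s _; rewrite unfold_in -card_gt0 /dim.
  by case: (s \in _); case: #|s| => // m; rewrite /= ?eqSS; case: (_ == _).
rewrite exchange_big; apply: eq_bigr => s /eqP sk.
have s0 : s != set0 by rewrite -card_gt0 sk.
(* The leading 1 becomes the total mass, so that the difference is taken
   hypergraph by hypergraph. *)
rewrite -avoid_probE// -[X in X - _](hypergraph_prob_total p) -sumrB.
by apply: eq_bigr => X _; case: (s \in _); rewrite /= ?mulr0 ?mulr1 ?subr0 ?subrr.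
Qed.
End Closure.

(** * Probability that one of several independent events occurs *)

Section UnionBound.
Variables (R : realType) (I : finType) (P : pred I) (x : I -> R).
Hypothesis x01 : forall i, P i -> 0 <= x i <= 1.

(** The induction also carries [0 <= q <= 1] for the partial product [q], which
    makes the cross term [x i * (1 - q)] nonnegative. *)
Lemma prod_onem_ge : 1 - \sum_(i | P i) x i <= \prod_(i | P i) (1 - x i).
Proof.
suff [] : 1 - \sum_(i | P i) x i <= \prod_(i | P i) (1 - x i) /\
   0 <= \prod_(i | P i) (1 - x i) <= 1 by [].
elim/big_rec2: _ => [|i S q Pi [IH /andP[q0 q1]]]; first by rewrite subr0 ler01 lexx.
have /andP[xi0 xi1] := x01 Pi; split; first by nra.
by apply/andP; split; nra.
Qed.

(** Follows from [1 - x <= expR (- x)] and [1 + S <= expR S]. *)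
Lemma prod_onem_le : \prod_(i | P i) (1 - x i) <= (1 + \sum_(i | P i) x i)^-1.
Proof.
have S0 : 0 <= \sum_(i | P i) x i by apply: sumr_ge0 => i /x01 /andP[].
apply: (@le_trans _ _ (expR (- \sum_(i | P i) x i))).
  rewrite -sumrN expR_sum; apply: ler_prod => i /x01 /andP[x0 x1].
  by rewrite subr_ge0 x1 expR_ge1Dx.
by rewrite expRN lef_pV2 ?posrE ?expR_gt0 ?expR_ge1Dx//; lra.
Qed.

(** The lower bound stays useful when [S] is large, where the second-order
    Bonferroni bound [S - S ^+ 2 / 2] becomes negative. *)
Lemma onem_prod_bounds (S := \sum_(i | P i) x i) :
  S / (1 + S) <= 1 - \prod_(i | P i) (1 - x i) <= Num.min 1 S.
Proof.
have S0 : 0 <= S by apply: sumr_ge0 => i /x01 /andP[].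
apply/andP; split.
  have -> : S / (1 + S) = 1 - (1 + S)^-1 by field; lra.
  by rewrite lerB// prod_onem_le.
rewrite le_min; apply/andP; split.
  rewrite gerBl; apply: prodr_ge0 => i /x01 /andP[_].
  by rewrite subr_ge0.
by have := prod_onem_ge; rewrite -/S; lra.
Qed.
End UnionBound.

(** * Cofaces of a simplex *)

(** Complementation turns the sets of size [m] above [s] into the sets of size
    [#|V| - m] below the complement of [s]. *)
Lemma card_supersets (V : finType) (s : {set V}) (m : nat) : (#|s| <= m)%N ->
  #|[set t : {set V} | s \subset t & #|t| == m]| = 'C(#|V| - #|s|, m - #|s|).
Proof.
have card_le (t : {set V}) : (#|t| <= #|V|)%N by exact: max_card.
move=> sm; have [mV|Vm] := leqP m #|V|; last first.
  rewrite bin_small; last by have := card_le s; lia.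
  apply/eqP; rewrite cards_eq0; apply/eqP/setP => t; rewrite !inE.
  by apply/negP => /andP[_ /eqP tm]; have := card_le t; lia.
have -> : (m - #|s| = (#|V| - #|s|) - (#|V| - m))%N by lia.
rewrite bin_sub; last by lia.
have -> : (#|V| - #|s| = #|~: s|)%N by rewrite (cardsCs (~: s)) setCK.
rewrite -cards_draws -(card_imset _ (inv_inj (@setCK V))).
apply: eq_card => t; rewrite -[t]setCK mem_imset; last exact: inv_inj (@setCK V).
rewrite !inE setCS setCK (cardsCs (~: t)) setCK.
by congr (_ && _); have := card_le t; lia.
Qed.

Section Expected.
Variables (R : realType) (r : nat) (alpha : 'I_r.+1 -> R).
Hypothesis alpha_ge0 : forall i, 0 <= alpha i.

(** The expected number of members of the random hypergraph that contain a
    given [k]-simplex, itself included; the summand [i] accounts for those of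
    dimension [i], determined by their [i - k] vertices among the [n.+1 - k.+1]
    outside the simplex. *)
Definition expected_cofaces (k n : nat) : R :=
  \sum_(i < r.+1 | (k <= i)%N) 'C(n.+1 - k.+1, i - k)%:R * n%:R `^ (- alpha i).

(** When [n = 0] the value [0 `^ (- alpha i)] is [0] or [1], so the bounds hold
    there as well. *)
Lemma face_prob01 n (s : {set 'I_n.+1}) : 0 <= face_prob alpha s <= 1.
Proof.
rewrite /face_prob; case: insubP => [i _ _|_]; last by rewrite lexx ler01.
rewrite powR_ge0/=; case: n s => [|n] s.
  by rewrite /powR eqxx; case: (_ == 0).
by rewrite -[leRHS](powRr0 n.+1%:R) ler_powR ?ler1n// oppr_le0.
Qed.

(** The sum depends on [s] only through its dimension, which is what makes the
    estimate for the coverage probability uniform in [s]. *)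
Lemma sum_face_prob n k (s : {set 'I_n.+1}) : #|s| = k.+1 ->
  \sum_(t in simplexes 'I_n.+1 | s \subset t) face_prob alpha t
  = expected_cofaces k n.
Proof.
move=> sk; have s0 : s != set0 by rewrite -card_gt0 sk.
have dim_ge (t : {set 'I_n.+1}) : s \subset t -> (k.+1 <= #|t|)%N.
  by move=> /subset_leq_card; rewrite sk.
transitivity (\sum_(i < r.+1 | (k <= i)%N)
   \sum_(t : {set 'I_n.+1} | (s \subset t) && (#|t| == i.+1)) n%:R `^ (- alpha i)).
  rewrite (exchange_big_dep (fun t : {set 'I_n.+1} => s \subset t))/=; last first.
    by move=> i t _ /andP[].
  rewrite (eq_bigl (fun t : {set 'I_n.+1} => s \subset t)); last first.
    move=> t; rewrite inE; case: (boolP (s \subset t)) => [st|]; last by rewrite andbF.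
    by rewrite andbT -card_gt0 (leq_trans _ (dim_ge _ st)).
  apply: eq_bigr => t st; have := dim_ge _ st => kt.
  rewrite /face_prob; case: insubP => [i _ it|].
    rewrite (big_pred1 i)// => j /=; rewrite st /= /dim in it *.
    apply/andP/eqP => [[_ /eqP tj]|->]; first by apply: val_inj; rewrite /= it tj.
    by rewrite it; split; first lia; rewrite prednK//; lia.
  rewrite ltnS -ltnNge /dim => rt; rewrite big_pred0// => j.
  apply/negP => /andP[_ /andP[_ /eqP tj]]; move: rt.
  by rewrite tj ltnNge -ltnS ltn_ord.
apply: eq_bigr => i ki; rewrite sumr_const [RHS]mulr_natl; congr (_ *+ _).
have <- : #|[set t : {set 'I_n.+1} | s \subset t & #|t| == i.+1]|
    = 'C(n.+1 - k.+1, i - k).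
  by rewrite card_supersets sk ?card_ord// subSS.
by apply: eq_card => t; rewrite inE.
Qed.

Lemma expected_faces_bounds k n (S := expected_cofaces k n) :
  'C(n.+1, k.+1)%:R * (S / (1 + S)) <= expected_faces alpha k n
    <= 'C(n.+1, k.+1)%:R * Num.min 1 S.
Proof.
have faces (c : R) : 'C(n.+1, k.+1)%:R * c =
    \sum_(s : {set 'I_n.+1} | #|s| == k.+1) c.
  rewrite sumr_const mulr_natl; congr (_ *+ _).
  by rewrite -[in LHS](card_ord n.+1) -card_draws; apply: eq_card => s; rewrite inE.
rewrite /expected_faces upper_expectation_face_count !faces.
apply/andP; split; apply: ler_sum => s /eqP sk;
  rewrite /S -(sum_face_prob sk) /avoid_prob;
  by have /andP[] := onem_prod_bounds
    (fun t (_ : (t \in simplexes 'I_n.+1) && (s \subset t)) => face_prob01 t).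
Qed.
End Expected.

(** * Polynomial orders of growth *)

Section Growth.
Variable R : realType.
Implicit Types (u v w : R^nat) (g h : R).

(** The relation [u n = Theta (n ^ g)].  Both bounds are kept, since both are
    needed to recover [g] from logarithms and to pass through a saturation. *)
Definition has_growth u g : Prop :=
  exists c C : R, 0 < c /\
    \forall n \near \oo, c * n%:R `^ g <= u n <= C * n%:R `^ g.

Lemma has_growth_powR g : has_growth (fun n => n%:R `^ g) g.
Proof.
by exists 1, 1; split=> //; near=> n; rewrite !mul1r lexx.
Unshelve. all: by end_near. Qed.

Lemma has_growth_squeeze u v w g :
  (\forall n \near \oo, u n <= v n <= w n) ->
  has_growth u g -> has_growth w g -> has_growth v g.
Proof.
move=> uvw [c [C' [c0 uc]]] [c' [C [_ wC]]]; exists c, C; split=> //.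
near=> n; have /andP[uv vw] : u n <= v n <= w n by near: n.
apply/andP; split.
  by apply: le_trans uv; have /andP[] : c * n%:R `^ g <= u n <= C' * n%:R `^ g by near: n.
apply: (le_trans vw).
by have /andP[_] : c' * n%:R `^ g <= w n <= C * n%:R `^ g by near: n.
Unshelve. all: by end_near. Qed.

Lemma has_growthM u v g h :
  has_growth u g -> has_growth v h -> has_growth (u \* v) (g + h).
Proof.
move=> [c [C [c0 uC]]] [d [D [d0 vD]]]; exists (c * d), (C * D).
split; first exact: mulr_gt0.
near=> n; have n0 : 0 < n%:R :> R by rewrite ltr0n; near: n; exact: nbhs_infty_gt.
have /andP[u1 u2] : c * n%:R `^ g <= u n <= C * n%:R `^ g by near: n.
have /andP[v1 v2] : d * n%:R `^ h <= v n <= D * n%:R `^ h by near: n.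
rewrite powRD; last by rewrite (gt_eqF n0) implybT.
rewrite !(mulrACA _ _ (n%:R `^ g)) /=.
have u0 : 0 <= c * n%:R `^ g by rewrite mulr_ge0 ?powR_ge0 ?ltW.
have v0 : 0 <= d * n%:R `^ h by rewrite mulr_ge0 ?powR_ge0 ?ltW.
by apply/andP; split; apply: ler_pM => //; [exact: le_trans u1|exact: le_trans v1].
Unshelve. all: by end_near. Qed.

(** The dominant term alone gives the lower bound, as every term is eventually
    nonnegative; ties between exponents only change the constants. *)
Lemma has_growth_sum (I : finType) (P : pred I) (u : I -> R^nat) (g : I -> R) j :
  P j -> (forall i, P i -> has_growth (u i) (g i)) -> (forall i, P i -> g i <= g j) ->
  has_growth (fun n => \sum_(i | P i) u i n) (g j).
Proof.
move=> Pj ug gj.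
have /choice[c Hc] : forall i, exists c : R * R, P i -> 0 < c.1 /\
    \forall n \near \oo, c.1 * n%:R `^ g i <= u i n <= c.2 * n%:R `^ g i.
  move=> i; have [Pi|_] := boolP (P i); last by exists (0, 0).
  by have [c [C [c0 ?]]] := ug i Pi; exists (c, C).
exists (c j).1, (\sum_(i | P i) `|(c i).2|); split; first exact: (Hc j Pj).1.
have nearP : \forall n \near \oo, forall i, P i ->
    (c i).1 * n%:R `^ g i <= u i n <= (c i).2 * n%:R `^ g i.
  apply: filter_forall => i; have [Pi|_] := boolP (P i).
    by apply: filterS (Hc i Pi).2 => n.
  by near=> n.
near=> n.
have n1 : 1 <= n%:R :> R by rewrite ler1n; near: n; exact: nbhs_infty_gt.
have bounds : forall i, P i -> (c i).1 * n%:R `^ g i <= u i n <= (c i).2 * n%:R `^ g i.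
  by near: n.
have u0 i : P i -> 0 <= u i n.
  move=> Pi; have /andP[+ _] := bounds i Pi; apply: le_trans.
  by rewrite mulr_ge0 ?powR_ge0// ltW// (Hc i Pi).1.
apply/andP; split.
  rewrite (bigD1 j)//=; have /andP[cu _] := bounds j Pj.
  by apply: (le_trans cu); rewrite lerDl sumr_ge0// => i /andP[/u0].
rewrite mulr_suml; apply: ler_sum => i Pi; have /andP[_ uc] := bounds i Pi.
apply: (@le_trans _ _ (`|(c i).2| * n%:R `^ g i)).
  by apply: (le_trans uc); rewrite ler_wpM2r ?powR_ge0 ?ler_norm.
by rewrite ler_wpM2l// ler_powR// gj.
Unshelve. all: by end_near. Qed.

(** The lower bound holds because [x / (1 + x)] is increasing and
    [u n >= c * m] with [m = n ^ (min 0 g) <= 1], which gives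
    [c * m / (1 + c * m) >= c / (1 + c) * m]. *)
Lemma has_growth_saturate u v g :
  (\forall n \near \oo, u n / (1 + u n) <= v n <= Num.min 1 (u n)) ->
  has_growth u g -> has_growth v (Num.min 0 g).
Proof.
move=> uv [c [C [c0 uC]]]; exists (c / (1 + c)), (Num.max 1 C).
split; first by rewrite divr_gt0// addr_gt0.
near=> n.
have n1 : 1 <= n%:R :> R by rewrite ler1n; near: n; exact: nbhs_infty_gt.
have /andP[cu uC'] : c * n%:R `^ g <= u n <= C * n%:R `^ g by near: n.
have /andP[uv1 uv2] : u n / (1 + u n) <= v n <= Num.min 1 (u n) by near: n.
set m := n%:R `^ (Num.min 0 g).
have m1 : m <= 1 by rewrite -[leRHS](powRr0 n%:R) ler_powR// ge_min lexx.
have mg : m <= n%:R `^ g by rewrite ler_powR// ge_min lexx orbT.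
have m0 : 0 <= m by exact: powR_ge0.
apply/andP; split.
  apply: le_trans uv1; have cmu : c * m <= u n by apply: le_trans cu; rewrite ler_pM2l.
  have u0 : 0 <= u n by apply: le_trans cmu; rewrite mulr_ge0// ltW.
  have cmul : c * m * u n <= c * u n by rewrite mulrAC ler_piMr// mulr_ge0// ltW.
  rewrite mulrAC ler_pdivrMr ?addr_gt0// mulrAC ler_pdivlMr ?ltr_wpDr//.
  by rewrite !mulrDr !mulr1 [u n * c]mulrC lerD.
apply: (le_trans uv2); rewrite /m; have [g0|g0] := leP 0 g.
  by rewrite powRr0 mulr1 ge_min le_max lexx.
rewrite ge_min; apply/orP; right; apply: (le_trans uC').
by rewrite ler_wpM2r ?powR_ge0// le_max lexx orbT.
Unshelve. all: by end_near. Qed.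

Lemma ln_natr_pinfty : ln (n%:R : R) @[n --> \oo] --> +oo.
Proof.
apply/cvgryPge => A; near=> n.
have An : expR A <= n%:R by near: n; exact: nbhs_infty_ger.
by rewrite -(expRK A) ler_ln ?posrE ?expR_gt0// (lt_le_trans _ An) ?expR_gt0.
Unshelve. all: by end_near. Qed.

(** Taking logarithms, the constants contribute [ln c / ln n], which tends to
    [0]. *)
Lemma has_growth_cvg u g : has_growth u g -> ln (u n) / ln n%:R @[n --> \oo] --> g.
Proof.
move=> [c [C [c0 uC]]].
have shift (a : R) : ln a / ln n%:R + g @[n --> \oo] --> g.
  rewrite -[X in _ --> X]add0r -(mulr0 (ln a)); apply: cvgD; last exact: cvg_cst.
  apply: cvgM; first exact: cvg_cst.
  apply/gtr0_cvgV0; last exact: ln_natr_pinfty.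
  by near=> n; rewrite ln_gt0// ltr1n; near: n; exact: nbhs_infty_gt.
apply: (squeeze_cvgr _ (shift c) (shift C)); near=> n.
have n1 : 1 < n%:R :> R by rewrite ltr1n; near: n; exact: nbhs_infty_gt.
have /andP[cu uC'] : c * n%:R `^ g <= u n <= C * n%:R `^ g by near: n.
have n0 : 0 < n%:R :> R by exact: lt_trans n1.
have ng : 0 < n%:R `^ g by exact: powR_gt0.
have u0 : 0 < u n by apply: lt_le_trans cu; rewrite mulr_gt0.
have C0 : 0 < C by rewrite -(pmulr_lgt0 _ ng) (lt_le_trans u0).
have lnn : 0 < ln (n%:R : R) by rewrite ln_gt0.
have shiftE (a : R) : 0 < a -> ln a / ln n%:R + g = ln (a * n%:R `^ g) / ln n%:R.
  by move=> a0; rewrite lnM ?posrE// ln_powR mulrDl mulfK// gt_eqF.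
by rewrite !shiftE// !ler_pM2r ?invr_gt0// !ler_ln ?posrE ?mulr_gt0// cu.
Unshelve. all: by end_near. Qed.

Lemma leq_wexpn2r m n e : (m <= n)%N -> (m ^ e <= n ^ e)%N.
Proof. by case: e => // e mn; rewrite leq_exp2r. Qed.

Lemma leq_expn_ffact m j : (j <= m)%N -> ((m - j).+1 ^ j <= m ^_ j)%N.
Proof.
elim: j m => [//|j IH] [//|m] jm; rewrite ffactSS expnS leq_mul//; first lia.
by rewrite subSS IH.
Qed.

Lemma leq_ffact_expn m j : (m ^_ j <= m ^ j)%N.
Proof.
elim: j m => [//|j IH] [//|m]; rewrite ffactSS expnS leq_mul//.
by apply: leq_trans (IH m) _; exact: leq_wexpn2r.
Qed.

(** For large [n] all [j] factors of the falling factorial lie between [n / 2] and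
    [2 * n]. *)
Lemma has_growth_binomial l j : has_growth (fun n => 'C(n.+1 - l, j)%:R) j%:R.
Proof.
exists ((2 ^ j * j`!)%N%:R^-1), (2 ^ j)%:R; split.
  by rewrite invr_gt0 ltr0n muln_gt0 expn_gt0 fact_gt0.
near=> n.
have n0 : (0 < n)%N by near: n; exact: nbhs_infty_gt.
have nlj : (2 * (l + j) <= n)%N by near: n; exact: nbhs_infty_ge.
rewrite powR_mulrn// -natrX; apply/andP; split.
  rewrite ler_pdivrMl ?ltr0n ?muln_gt0 ?expn_gt0 ?fact_gt0// -natrM ler_nat.
  rewrite -mulnA [(j`! * _)%N]mulnC bin_ffact.
  apply: (@leq_trans ((2 * (n.+1 - l - j).+1) ^ j)); first by apply: leq_wexpn2r; lia.
  by rewrite expnMn leq_mul2l leq_expn_ffact ?orbT//; lia.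
rewrite -natrM ler_nat -expnMn.
apply: (@leq_trans ((n.+1 - l) ^_ j)).
  by rewrite -bin_ffact leq_pmulr ?fact_gt0.
by apply: leq_trans (leq_ffact_expn _ _) _; apply: leq_wexpn2r; lia.
Unshelve. all: by end_near. Qed.

End Growth.

(** * The growth exponents of the face numbers *)

Section FaceGrowth.
Variables (R : realType) (r : nat) (alpha : 'I_r.+1 -> R).
Implicit Types i k : 'I_r.+1.

Lemma beta_star_from_attained k :
  exists2 i : 'I_r.+1, (k <= i)%N & beta_star_from alpha k = beta alpha i.
Proof.
rewrite /beta_star_from.
elim/big_ind: _ => [|x y [i ki ->] [j kj ->]|i ki]; [by exists k| |by exists i].
by case: leP => _; [exists j|exists i].
Qed.

Lemma le_beta_star_from k i : (k <= i)%N -> beta alpha i <= beta_star_from alpha k.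
Proof. by move=> ki; apply: (le_bigmax_cond _ (beta alpha)). Qed.

Lemma le_beta_star i : beta alpha i <= beta_star alpha.
Proof. exact: le_bigmax. Qed.

Lemma beta_star_attained : exists i, beta_star alpha = beta alpha i.
Proof.
by have [i _ bi] := beta_star_from_attained ord0; exists i.
Qed.

Lemma beta_star_from_le k : beta_star_from alpha k <= beta_star alpha.
Proof. by have [i _ ->] := beta_star_from_attained k; exact: le_beta_star. Qed.

Lemma beta_star_from_eq k i : (k <= i)%N -> beta alpha i = beta_star alpha ->
  beta_star_from alpha k = beta_star alpha.
Proof.
move=> ki bi; apply/eqP; rewrite eq_le beta_star_from_le/= -bi.
exact: le_beta_star_from.
Qed.

Hypothesis alpha_gt0 : forall i, 0 < alpha i.

Lemma has_growth_expected_cofaces k :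
  has_growth (expected_cofaces alpha k) (beta_star_from alpha k - (k%:R + 1)).
Proof.
have [j kj bj] := beta_star_from_attained k.
have exponent (i : 'I_r.+1) : (k <= i)%N ->
    (i - k)%N%:R - alpha i = beta alpha i - (k%:R + 1).
  by move=> ki; rewrite natrB// /beta; ring.
rewrite bj -exponent//.
apply: (@has_growth_sum _ _ (fun i : 'I_r.+1 => (k <= i)%N)
  (fun (i : 'I_r.+1) n => 'C(n.+1 - k.+1, i - k)%:R * n%:R `^ (- alpha i))
  (fun i : 'I_r.+1 => (i - k)%N%:R - alpha i)) => // i ki.
  exact: has_growthM (has_growth_binomial _ _ _) (has_growth_powR _).
by rewrite !exponent// lerB// -bj le_beta_star_from.
Qed.

(** Dividing by the number of candidates turns the bounds on the expectation into
    bounds of the form required by [has_growth_saturate]. *)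
Lemma has_growth_expected_faces k :
  has_growth (expected_faces alpha k) (Num.min (k%:R + 1) (beta_star_from alpha k)).
Proof.
pose C n : R := 'C(n.+1, k.+1)%:R.
have growthC : has_growth C (k%:R + 1).
  by rewrite natr1; exact: (has_growth_binomial _ 0 k.+1).
have C_gt0 : \forall n \near \oo, 0 < C n.
  near=> n; rewrite ltr0n bin_gt0 ltnS; near: n; exact: nbhs_infty_ge.
have growthE : has_growth (fun n => expected_faces alpha k n / C n)
    (Num.min 0 (beta_star_from alpha k - (k%:R + 1))).
  apply: has_growth_saturate (has_growth_expected_cofaces k); near=> n.
  have Cn : 0 < C n by near: n.
  rewrite ler_pdivlMr// ler_pdivrMr// ![_ * C n]mulrC.
  by apply: expected_faces_bounds => i; exact: ltW.
have -> : Num.min (k%:R + 1) (beta_star_from alpha k) =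
    (k%:R + 1) + Num.min 0 (beta_star_from alpha k - (k%:R + 1)).
  by rewrite addr_minr addr0 [_ + (_ - _)]addrC subrK.
apply: (has_growth_squeeze _ (has_growthM growthC growthE) (has_growthM growthC growthE)).
near=> n; have Cn : 0 < C n by near: n.
by rewrite /= mulrC divfK ?lexx// gt_eqF.
Unshelve. all: by end_near. Qed.

Lemma cvg_growth_seq k : growth_seq alpha k n @[n --> \oo]
  --> Num.min (k%:R + 1) (beta_star_from alpha k).
Proof. exact/has_growth_cvg/has_growth_expected_faces. Qed.

Lemma gammaE k : gamma alpha k = Num.min (k%:R + 1) (beta_star_from alpha k).
Proof. by apply/cvg_lim => //; exact: cvg_growth_seq. Qed.

Lemma beta_lt i : beta alpha i < i%:R + 1.
Proof. by rewrite /beta ltrBlDr ltrDl. Qed.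

Lemma beta_inj : (forall i j, i != j -> alpha i - alpha j \isn't a Num.int) ->
  injective (beta alpha).
Proof.
move=> alphaB i j bij; apply/eqP; apply: contraT => /alphaB /negP[].
have -> : alpha i - alpha j = i%:R - j%:R by move: bij; rewrite /beta; lra.
by rewrite rpredB ?natr_int.
Qed.
End FaceGrowth.

Theorem theorem11p9 (R : realType) (r : nat) (alpha : 'I_r.+1 -> R)
    (alpha_gt0 : forall i, 0 < alpha i)
    (alpha_nint : forall i, alpha i \isn't a Num.int)
    (alphaB_nint : forall i j, i != j -> alpha i - alpha j \isn't a Num.int) :
  (exists! i : 'I_r.+1, beta alpha i = beta_star alpha) /\
  forall istar : 'I_r.+1, beta alpha istar = beta_star alpha ->
    (forall k : 'I_r.+1,
      [/\ cvgn (growth_seq alpha k),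
          (k%:Z < critical_dim alpha -> gamma alpha k = k%:R + 1),
          (critical_dim alpha <= k%:Z -> (k <= istar)%N ->
             gamma alpha k = beta_star alpha)
        & ((istar < k)%N -> gamma alpha k = beta_star_from alpha k)]) /\
    (forall k : 'I_r.+1, critical_dim alpha <= k%:Z -> (k <= istar)%N ->
       gamma alpha k = beta_star alpha /\
       forall j : 'I_r.+1, gamma alpha j <= gamma alpha k).
Proof.
split.
  have [i bi] := beta_star_attained alpha.
  by exists i; split=> // j bj; apply: (beta_inj alphaB_nint); rewrite bj.
move=> istar bistar.
have bmax (k : 'I_r.+1) : (k <= istar)%N -> beta_star_from alpha k = beta_star alpha.
  by move=> ki; exact: beta_star_from_eq bistar.
have plateau (k : 'I_r.+1) : critical_dim alpha <= k%:Z -> (k <= istar)%N ->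
    gamma alpha k = beta_star alpha.
  move=> ck ki; rewrite gammaE// bmax// min_r// ltW//.
  apply: lt_le_trans (floorD1_gt _) _.
  by rewrite -[leRHS]/(k%:Z%:~R + 1%:~R) -intrD ler_int lerD2r.
split=> [k|k ck ki]; last first.
  split=> [|j]; first exact: plateau.
  rewrite (plateau k)// gammaE// (le_trans _ (beta_star_from_le alpha j))//.
  by rewrite ge_min lexx orbT.
split.
- by apply/cvg_ex; eexists; exact: cvg_growth_seq.
- move=> kc; have kb : k%:R + 1 <= beta_star alpha.
    have := floor_le (beta_star alpha); apply: le_trans.
    by rewrite -[leLHS]/(k%:Z%:~R + 1%:~R) -intrD ler_int -/(critical_dim alpha) lezD1.
  have ki : (k <= istar)%N.
    have := beta_lt alpha_gt0 istar; rewrite bistar => /(le_lt_trans kb).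
    by rewrite ltrD2r ltr_nat => /ltnW.
  by rewrite gammaE// bmax// min_l.
- exact: plateau.
- move=> ik; rewrite gammaE// min_r//.
  apply: le_trans (beta_star_from_le alpha k) _; rewrite -bistar.
  by apply: ltW (lt_le_trans (beta_lt alpha_gt0 istar) _); rewrite lerD2r ler_nat ltnW.
Qed.
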